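(* Let $T$ be a tree of order $n \geq 4$ with maximum degree $\Delta(T) \geq 3$. Then $$\mathrm{hc}(T) \geq (n-1)(n-1-\zeta(T)) + \zeta'(T) - 2\mathcal{L}_W(T).$$
   Context: For a connected graph $G$ of order $n$, the detour distance $D(u,v)$ is the length of a longest $u$–$v$ path (in a tree it equals the ordinary distance $d(u,v)$). A hamiltonian coloring of $G$ is a map $h: V(G) \to \{0,1,2,\ldots\}$ such that $D(u,v) + |h(u)-h(v)| \geq n-1$ for all distinct $u,v \in V(G)$. Its span is $\max\{|h(u)-h(v)| : u,v \in V(G)\}$, and the hamiltonian chromatic number $\mathrm{hc}(G)$ is the minimum span over all hamiltonian colorings of $G$. For a tree $T$ and $v \in V(T)$ let $w_T(v) = \sum_{u \in V(T)} d(u,v)$; a weight center of $T$ is a vertex minimizing $w_T$, and $W(T)$ denotes the set of weight centers (it consists of one vertex $w$, or of two adjacent vertices $w,w'$). Set $\zeta(T) = 0$ if $|W(T)| = 1$ and $\zeta(T) = 1$ if $|W(T)| = 2$, and $\zeta'(T) = 1 - \zeta(T)$. For $u \in V(T)$ let $\mathcal{L}(u) = \min\{D(u,x) : x \in W(T)\}$, and let $\mathcal{L}_W(T) = \sum_{u \in V(T)} \mathcal{L}(u)$. *)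

(* Defs.v *)
From mathcomp Require Import all_boot all_order all_algebra.
From mathcomp Require Import boolp.
Set Implicit Arguments.
Unset Strict Implicit.
Unset Printing Implicit Defensive.

Section Graph.
Variables (V : finType) (e : rel V).

Definition simple_graph : Prop := symmetric e /\ irreflexive e.

Definition connected_graph : Prop := forall u v : V, connect e u v.

(* [ucycle] requires distinct vertices; sequences of size 1 and 2 are not
   cycles of a simple graph. *)
Definition acyclic_graph : Prop :=
  forall c : seq V, 3 <= size c -> ~ ucycle e c.

Definition is_tree : Prop :=
  [/\ simple_graph, connected_graph & acyclic_graph].

Definition degree (v : V) : nat := #|[set u | e v u]|.

Definition max_degree : nat := \max_(v : V) degree v.

(* The path has vertex sequence u :: p, so its length is [size p]. *)
Definition upath (u v : V) (p : seq V) : bool :=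
  [&& path e u p, last u p == v & uniq (u :: p)].

Definition has_upath (u v : V) (k : nat) : bool :=
  [exists p : k.-tuple V, upath u v p].

(* In both definitions the range k < #|V| covers all path lengths, since the
   vertices of a path are distinct.  The value #|V| of [dist] is only reached
   when there is no path from u to v. *)
Definition detour (u v : V) : nat :=
  \max_(k < #|V| | has_upath u v k) k.

Definition dist (u v : V) : nat :=
  \big[minn/#|V|]_(k < #|V| | has_upath u v k) k.

Definition hamiltonian_coloring (h : V -> nat) : Prop :=
  forall u v : V, u != v -> #|V| - 1 <= detour u v + `|h u - h v|.

Definition span (h : V -> nat) : nat :=
  \max_(u : V) \max_(v : V) `|h u - h v|.

Lemma ex_hamiltonian_span :
  exists k : nat, `[< exists h, hamiltonian_coloring h /\ span h = k >].
Proof.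
pose h (u : V) := enum_rank u * #|V|.
exists (span h); apply/asboolP; exists h; split=> // u v neq_uv.
have : nat_of_ord (enum_rank u) != enum_rank v.
  by rewrite (inj_eq val_inj) (inj_eq enum_rank_inj).
rewrite /h => neq; apply: leq_trans (leq_addl _ _).
apply: leq_trans (leq_subr _ _) _.
wlog lt : u v {neq_uv neq} / enum_rank u < enum_rank v.
  by move=> wl; move: neq; rewrite neq_ltn => /orP[/wl //|/wl]; rewrite distnC.
rewrite distnEr ?leq_mul2r ?(ltnW lt) ?orbT // -mulnBl.
by rewrite leq_pmull // subn_gt0.
Qed.

Definition hc : nat := ex_minn ex_hamiltonian_span.

Definition weight (v : V) : nat := \sum_(u : V) dist u v.

Definition weight_centers : {set V} :=
  [set v | [forall u, weight v <= weight u]].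

Definition zeta : nat := if #|weight_centers| == 2 then 1 else 0.

Definition zeta' : nat := 1 - zeta.

(* #|V| exceeds every value of [detour], so it is a neutral default for the
   minimum over the nonempty set of weight centers. *)
Definition level (u : V) : nat :=
  \big[minn/#|V|]_(x in weight_centers) detour u x.

Definition total_level : nat := \sum_(u : V) level u.

End Graph.

(* Main.v *)
Require Import Defs.
From mathcomp Require Import all_boot all_order all_algebra.
From mathcomp Require Import boolp zify.
Import Order.TTheory GRing.Theory Num.Theory.
Local Open Scope ring_scope.

(** In a tree, paths are unique, so [dist] and [detour] coincide and form a
    metric in which a point lying between [v] and [w] lies between [u] and [v]
    or between [u] and [w], for every [u].  If two weight centers [v], [w] were
    at distance at least 2, moving both one step towards each other would
    strictly decrease [weight v + weight w]; hence weight centers are pairwise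
    adjacent and there are at most two of them.  Consequently
    [D(u, v) <= L(u) + L(v) + zeta].  List the vertices by increasing color and
    add up the coloring inequalities of consecutive vertices: every level is
    counted twice, except those of the first and the last vertex, which cannot
    both vanish if the weight center is unique. *)

(** * Minima over a finite type with a default value *)

Section Bigminn.
Set Implicit Arguments.
Unset Strict Implicit.
Local Open Scope nat_scope.
Variables (I : finType) (m : nat) (P : pred I) (F : I -> nat).

Lemma bigminn_le (i : I) : P i -> \big[minn/m]_(j | P j) F j <= F i.
Proof.
move=> Pi; have := mem_index_enum i; elim: (index_enum I) => // j r IHr.
rewrite inE big_cons => /predU1P[<-|/IHr le_r]; first by rewrite Pi geq_minl.
by case: ifP => // _; apply: leq_trans (geq_minr _ _) le_r.
Qed.

(** As [F i0 <= m], the default [m] cannot undercut the least value of [F] on [P]. *)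
Lemma bigminn_attained (i0 : I) : P i0 -> F i0 <= m ->
  exists2 i, P i & \big[minn/m]_(j | P j) F j = F i.
Proof.
move=> Pi0 le_m; case: (arg_minnP F Pi0) => i Pi min_i.
exists i => //; apply/eqP; rewrite eqn_leq bigminn_le //=.
apply: (big_ind (fun k => F i <= k)) => [||j Pj]; last exact: min_i.
  exact: leq_trans (min_i _ Pi0) le_m.
by move=> k l le_k le_l; rewrite leq_min le_k.
Qed.

End Bigminn.

Section Tree.
Set Implicit Arguments.
Unset Strict Implicit.
Local Open Scope nat_scope.
Variables (V : finType) (e : rel V).
Hypothesis treeE : is_tree e.

Let e_sym : symmetric e. Proof. by case: treeE => -[]. Qed.
Let e_irr : irreflexive e. Proof. by case: treeE => -[]. Qed.

(** * Existence, reversal and uniqueness of paths in a tree *)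

Lemma upath_shorten (u v : V) (p : seq V) : path e u p -> last u p = v ->
  exists2 q, upath e u v q & {subset q <= p}.
Proof.
move=> + <-; case/shortenP => q eq_q uq sub_q.
by exists q; rewrite // /upath eq_q eqxx.
Qed.

Lemma upath_exists (u v : V) : exists p, upath e u v p.
Proof.
case: treeE => _ /(_ u v)/connectP[p ep vE] _.
by have [q] := upath_shorten ep (esym vE); exists q.
Qed.

Lemma path_rev (u v : V) (p : seq V) : path e u p -> last u p = v ->
  exists q, [/\ path e v q, last v q = u & v :: q = rev (u :: p)].
Proof.
move=> ep <-; exists (rev (belast u p)); split.
- by rewrite rev_path; apply: sub_path ep => x y; rewrite e_sym.
- by case: p ep => //= x p _; rewrite rev_cons last_rcons.
- by rewrite (lastI u p) rev_rcons.
Qed.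

Lemma upath_rev (u v : V) (p : seq V) : upath e u v p ->
  exists2 q, upath e v u q & v :: q = rev (u :: p).
Proof.
case/and3P=> ep /eqP vE up; have [q [eq uE qE]] := path_rev ep vE.
by exists q; rewrite // /upath eq uE eqxx qE rev_uniq.
Qed.

(* At the first vertex [x] where two paths diverge, their tails join the two
   distinct successors of [x] without visiting [x], which closes a cycle. *)
Lemma upath_unique (u v : V) (p q : seq V) :
  upath e u v p -> upath e u v q -> p = q.
Proof.
elim: p u q => [|a p IHp] u [|b q] //.
- case/and3P=> _ /= /eqP <- _ /and3P[_ /= /eqP uE].
  by rewrite -uE mem_last.
- move=> /[swap]; case/and3P=> _ /= /eqP <- _ /and3P[_ /= /eqP uE].
  by rewrite -uE mem_last.
case/and3P=> /= /andP[eua ep] /eqP pv /andP[nup up].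
case/and3P=> /= /andP[eub eq] /eqP qv /andP[nuq uq].
have [ab|neq_ab] := eqVneq a b.
  subst b; congr cons.
  by apply: (IHp a); apply/and3P; split=> //; apply/eqP.
have [q' [eq' q'b q'E]] := path_rev eq qv.
have epq : path e a (p ++ q') by rewrite cat_path ep pv.
have lpq : last a (p ++ q') = b by rewrite last_cat pv.
have [r /and3P[er /eqP rb ur] sub_r] := upath_shorten epq lpq.
have nur : u \notin a :: r.
  rewrite inE negb_or; move: nup; rewrite inE negb_or => /andP[-> nup] /=.
  apply: contra nuq => /sub_r; rewrite mem_cat (negbTE nup) /= => uq'.
  by rewrite -mem_rev -q'E inE uq' orbT.
case: treeE => _ _ /(_ [:: u, a & r])[].
  by case: r rb {er ur nur sub_r} => //= ab; rewrite ab eqxx in neq_ab.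
apply/andP; split; last by rewrite cons_uniq nur.
by rewrite /= eua rcons_path er rb e_sym.
Qed.

(** * The path metric *)

Lemma upath_size (u v : V) (p : seq V) : upath e u v p -> size p < #|V|.
Proof.
case/and3P=> _ _ up.
by rewrite -[(size p).+1]/(size (u :: p)) -(card_uniqP up) max_card.
Qed.

(** By uniqueness of paths, the maximum in [detour] and the minimum in [dist] range over one and the
    same length. *)
Lemma has_upathE (u v : V) (p : seq V) (k : nat) :
  upath e u v p -> has_upath e u v k = (k == size p).
Proof.
move=> up; apply/existsP/eqP => [[q uq]|->].
  by rewrite (upath_unique up uq) size_tuple.
by exists (in_tuple p).
Qed.

Lemma detourE (u v : V) (p : seq V) : upath e u v p -> detour e u v = size p.
Proof.
move=> up; rewrite /detour (big_pred1 (Ordinal (upath_size up))) //.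
by move=> k; rewrite (has_upathE _ up).
Qed.

Lemma dist_detour (u v : V) : dist e u v = detour e u v.
Proof.
have [p up] := upath_exists u v; rewrite (detourE up) /dist.
pose k0 := Ordinal (upath_size up).
have Pk0 : has_upath e u v k0 by rewrite (has_upathE _ up).
have [k] := bigminn_attained (P := fun k : 'I_#|V| => has_upath e u v k)
  (F := @nat_of_ord #|V|) Pk0 (ltnW (ltn_ord k0)).
by rewrite (has_upathE _ up) => /eqP <-.
Qed.

Local Notation d := (detour e).

Lemma detour_lt_card (u v : V) : d u v < #|V|.
Proof.
by have [p up] := upath_exists u v; rewrite (detourE up) (upath_size up).
Qed.

Lemma detour_sym (u v : V) : d u v = d v u.
Proof.
have [p up] := upath_exists u v; have [q uq qE] := upath_rev up.
rewrite (detourE up) (detourE uq).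
by apply: succn_inj; rewrite -[RHS]/(size (v :: q)) qE size_rev.
Qed.

Lemma detourxx (u : V) : d u u = 0.
Proof. by rewrite (@detourE _ _ [::]) // /upath /= eqxx. Qed.

Lemma detour_edge (u v : V) : e u v -> d u v = 1.
Proof.
move=> euv; have neq_uv : u != v by apply: contraTneq euv => ->; rewrite e_irr.
by rewrite (@detourE _ _ [:: v]) // /upath /= euv eqxx inE neq_uv.
Qed.

Lemma detour_eq0 (u v : V) : d u v = 0 -> u = v.
Proof.
have [p up] := upath_exists u v; rewrite (detourE up) => /size0nil p0.
by move: up; rewrite p0 => /and3P[_ /eqP].
Qed.

Lemma detour_eq1 (u v : V) : d u v = 1 -> e u v.
Proof.
have [p up] := upath_exists u v; rewrite (detourE up).
case: p up => [|a []] //= /and3P[/= /andP[eua _] /eqP <- _] _ //.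
Qed.

(** Although [detour] is a maximum, any walk bounds it: the walk shortens to the unique path. *)
Lemma path_detour (u v : V) (p : seq V) :
  path e u p -> last u p = v -> d u v <= size p.
Proof.
move=> ep pv; have [q uq sub_q] := upath_shorten ep pv.
rewrite (detourE uq); apply: uniq_leq_size sub_q.
by case/and3P: uq => _ _ /andP[].
Qed.

Lemma detour_triangle (v u w : V) : d u w <= d u v + d v w.
Proof.
have [p up] := upath_exists u v; have [q uq] := upath_exists v w.
rewrite (detourE up) (detourE uq) -size_cat.
case/and3P: up => ep /eqP pv _; case/and3P: uq => eq /eqP qw _.
by apply: path_detour; rewrite ?cat_path ?last_cat pv ?ep.
Qed.

(** * Betweenness: equality in the triangle inequality *)

Lemma upath_between (u v x : V) (p : seq V) : upath e u v p ->
  x \in u :: p -> d u v = d u x + d x v.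
Proof.
move=> up xp; apply/eqP; rewrite eqn_leq detour_triangle /= (detourE up).
case/and3P: up xp => + /eqP + _ => /[swap] pv + xp; rewrite -{}pv.
case/splitPl: xp => p1 p2 p1x; rewrite cat_path p1x last_cat => /andP[ep1 ep2].
by rewrite size_cat p1x leq_add // path_detour.
Qed.

(** The walk through [x] has the length of the path it shortens to, so no vertex, in particular not
    [x], gets lost. *)
Lemma between_upath (u v x : V) (p : seq V) : upath e u v p ->
  d u v = d u x + d x v -> x \in u :: p.
Proof.
move=> up dE; have [q uq] := upath_exists u x; have [r ur] := upath_exists x v.
move: dE; rewrite (detourE up) (detourE uq) (detourE ur) -size_cat => sp.
case/and3P: uq => eq /eqP qx _; case/and3P: ur => er /eqP rv _.
have eqr : path e u (q ++ r) by rewrite cat_path eq qx.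
have lqr : last u (q ++ r) = v by rewrite last_cat qx.
have [s us sub_s] := upath_shorten eqr lqr.
have us' : uniq s by case/and3P: us => _ _ /andP[].
rewrite -(upath_unique us up) in sp *.
have [_ sE] := uniq_min_size us' sub_s (eq_leq (esym sp)).
by have := mem_last u q; rewrite qx !inE sE mem_cat => /orP[->|->]; rewrite ?orbT.
Qed.

(* The path from [v] to [w] is contained in the walk from [v] to [w] via [u]. *)
Lemma between_tripod (u v w x : V) : d v w = d v x + d x w ->
  d v u = d v x + d x u \/ d u w = d u x + d x w.
Proof.
have [p up] := upath_exists v u; have [q uq] := upath_exists u w.
have /and3P[ep /eqP pu _] := up; have /and3P[eq /eqP qw _] := uq.
have epq : path e v (p ++ q) by rewrite cat_path ep pu.
have lpq : last v (p ++ q) = w by rewrite last_cat pu.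
have [s us sub_s] := upath_shorten epq lpq.
move/(between_upath us) => xs.
have: (x \in v :: p) || (x \in u :: q).
  move: xs; rewrite !inE => /predU1P[->|/sub_s]; first by rewrite eqxx.
  by rewrite mem_cat => /orP[]->; rewrite !orbT.
by case/orP=> [/(upath_between up)|/(upath_between uq)]; [left|right].
Qed.

Lemma detour_step (u v : V) : u != v ->
  exists2 x, d u x = 1 & d u v = 1 + d x v.
Proof.
have [[|x p] up] := upath_exists u v.
  by case/and3P: up => _ /eqP /= ->; rewrite eqxx.
move=> _; have eux : e u x by case/and3P: up => /= /andP[].
exists x; first exact: detour_edge.
by rewrite -(detour_edge eux) (upath_between (x := x) up) // !inE eqxx orbT.
Qed.

(** * Position and number of the weight centers *)

Lemma weight_centers_adjacent (v w : V) :
  v \in weight_centers e -> w \in weight_centers e -> v != w -> e v w.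
Proof.
rewrite !inE => /forallP minv /forallP minw neq_vw; apply: detour_eq1.
have [x vx dvx] := detour_step neq_vw.
have [y wy dwy] : exists2 y, d w y = 1 & d w v = 1 + d y v.
  by apply: detour_step; rewrite eq_sym.
rewrite (detour_sym w v) in dwy.
apply/eqP; case: eqP => // dvw_neq1.
suff: weight e x + weight e y < weight e v + weight e w.
  by have := minv x; have := minw y; lia.
rewrite /weight -!big_split /=.
under eq_bigr do rewrite !dist_detour.
under [X in _ < X]eq_bigr do rewrite !dist_detour.
(* If one of the two moves approaches [u], it gains 1 and the other loses at most 1. Otherwise [x]
   lies between [u] and [w], and [y] between [u] and [v], so the sum drops by [2 * (d v w - 1)]. *)
have le_u u : d u x + d u y <= d u v + d u w.
  have := @between_tripod u v w x; have := @between_tripod u v w y.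
  have := detour_triangle v u x; have := detour_triangle w u y.
  have := detour_sym u v; have := detour_sym u w; have := detour_sym u x.
  have := detour_sym u y; have := detour_sym v y; have := detour_sym w y; lia.
(* Strictness comes from the single vertex [x]: the right side is [d v w], and [x], [y] are closer
   together than [v], [w] because [d v w] is not 1. *)
have lt_x : d x x + d x y < d x v + d x w.
  have := @between_tripod x v w y; have := detour_sym x v.
  have := detour_sym x y; have := detour_sym v y; have := detour_sym w y.
  rewrite detourxx; lia.
rewrite (bigD1 x) //= [X in _ < X](bigD1 x) //= -addSn leq_add //.
exact: leq_sum.
Qed.

Lemma weight_centers_exist (v0 : V) : exists v, v \in weight_centers e.
Proof.
case: (arg_minnP (i0 := v0) (P := predT) (weight e)) => // v _ minv.
by exists v; rewrite inE; apply/forallP => u; apply: minv.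
Qed.

(** Three pairwise adjacent centers would form a triangle. *)
Lemma card_weight_centers : #|weight_centers e| <= 2.
Proof.
rewrite leqNgt; apply/negP => /card_gt2P[x [y [z [[xW yW zW] [xy yz zx]]]]].
case: treeE => _ _ /(_ [:: x; y; z])[] //; apply/andP; split.
  by rewrite /= !weight_centers_adjacent.
by rewrite /= !inE negb_or xy yz eq_sym zx.
Qed.

Lemma detour_weight_centers (v w : V) :
  v \in weight_centers e -> w \in weight_centers e -> d v w <= zeta e.
Proof.
move=> vW wW; have [->|neq_vw] := eqVneq v w; first by rewrite detourxx.
rewrite (detour_edge (weight_centers_adjacent vW wW neq_vw)) /zeta.
rewrite eqn_leq card_weight_centers /=.
suff ->: 1 < #|weight_centers e| by [].
by apply/card_gt1P; exists v, w.
Qed.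

(** * Levels *)

Lemma level_attained (u : V) :
  exists2 x, x \in weight_centers e & level e u = d u x.
Proof.
have [x0 x0W] := weight_centers_exist u.
exact: bigminn_attained x0W (ltnW (detour_lt_card u x0)).
Qed.

(** Walk from [u] to its nearest center, on to the center nearest to [v], and then to [v]. *)
Lemma detour_level (u v : V) : d u v <= level e u + level e v + zeta e.
Proof.
have [x xW ->] := level_attained u; have [y yW ->] := level_attained v.
have := detour_weight_centers xW yW; have := detour_sym v y.
by have := detour_triangle x u v; have := detour_triangle y x v; lia.
Qed.

Lemma level_eq0 (u : V) : level e u = 0 -> u \in weight_centers e.
Proof. by have [x xW ->] := level_attained u => /detour_eq0 ->. Qed.

(** Two distinct vertices of level 0 are two weight centers, which forces [zeta' e] to be 0. *)
Lemma zeta'_le_level (u v : V) : u != v -> zeta' e <= level e u + level e v.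
Proof.
move=> neq_uv; rewrite /zeta' /zeta; case: ifP => // card_neq2.
case: (posnP (level e u + level e v)) => [/eqP|//].
rewrite addn_eq0 => /andP[/eqP/level_eq0 uW /eqP/level_eq0 vW].
have: 1 < #|weight_centers e| by apply/card_gt1P; exists u, v.
by have := card_weight_centers; move/eqP: card_neq2; lia.
Qed.

End Tree.

(** * Summing separation inequalities; [K] and [f] will be [n - 1 - zeta e] and [level e] *)

Section Coloring.
Set Implicit Arguments.
Unset Strict Implicit.
Local Open Scope nat_scope.
Variables (V : finType) (h f : V -> nat) (K : nat).
Hypothesis h_sep : forall u v, u != v -> K <= f u + f v + `|h u - h v|.

(** Color differences telescope along the sorted list. The sum on the right doubles every [f],
    whereas the end vertices occur in one inequality each, hence [f x] and [f (last x s)] on the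
    left. *)
Lemma sorted_coloring_bound (x : V) (s : seq V) :
  path (relpre h leq) x s -> uniq (x :: s) ->
  K * size s + f x + f (last x s) + h x <=
    h (last x s) + 2 * \sum_(u <- x :: s) f u.
Proof.
elim: s x => [|y s IHs] x /=; first by rewrite big_seq1; lia.
case/andP=> le_xy ps /andP[x_ys u_ys]; have IH := IHs y ps u_ys.
have: x != y by apply: contraNneq x_ys => ->; rewrite mem_head.
move/h_sep; rewrite /= in le_xy; rewrite (distnEr le_xy) (big_cons _ _ x) /= mulnS; lia.
Qed.

Lemma coloring_span_bound (c : nat) : 1 < #|V| ->
  (forall u v, u != v -> c <= f u + f v) ->
  K * (#|V| - 1) + c <= Defs.span h + 2 * \sum_u f u.
Proof.
move=> V_gt1 f_ends; pose s := sort (relpre h leq) (enum V).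
have s_uniq : uniq s by rewrite sort_uniq enum_uniq.
have s_size : size s = #|V| by rewrite size_sort cardE.
have s_perm : perm_eq s (index_enum V).
  rewrite perm_sort; apply: uniq_perm; rewrite ?enum_uniq ?index_enum_uniq //.
  by move=> x; rewrite mem_enum mem_index_enum.
have s_sorted : sorted (relpre h leq) s.
  by apply: sort_sorted => x y; apply: leq_total.
rewrite -(perm_big _ s_perm) /=.
case: s s_uniq s_size s_sorted {s_perm} => [|x s] s_uniq s_size s_sorted.
  by rewrite -s_size in V_gt1.
have := sorted_coloring_bound s_sorted s_uniq.
(* The lowest and the highest vertex must differ for [f_ends] to apply to them. *)
have: x != last x s.
  case: s s_uniq s_size {s_sorted} => [|y s] + s_size.
    by rewrite -s_size in V_gt1.
  by rewrite cons_uniq => /andP[x_s _]; apply: contraNneq x_s => -> /=; apply: mem_last.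
move/f_ends; have: h (last x s) - h x <= Defs.span h.
  apply: leq_trans (leq_bigmax (last x s)).
  by apply: leq_trans (leq_bigmax x); lia.
by rewrite -s_size /= subn1 /=; lia.
Qed.

End Coloring.

Theorem theorem1 (V : finType) (e : rel V) (n : nat)
    (He : is_tree e) (Hn : #|V| = n) (Hn4 : (4 <= n)%N)
    (HD : (3 <= max_degree e)%N) :
  (n%:Z - 1) * (n%:Z - 1 - (zeta e)%:Z) + (zeta' e)%:Z
    - 2 * (total_level e)%:Z <= (hc e)%:Z.
Proof.
rewrite /hc; case: ex_minnP => k /asboolP[h [h_col <-]] _.
(* The bound of [detour_level] replaces the distance, and its [zeta e] moves to the left. *)
have h_sep u v : u != v ->
    (n - 1 - zeta e <= level e u + level e v + `|h u - h v|)%N.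
  move=> /h_col; have := detour_level He u v; rewrite Hn; lia.
have V_gt1 : (1 < #|V|)%N by rewrite Hn; lia.
have := coloring_span_bound h_sep V_gt1 (zeta'_le_level He).
(* Together with [4 <= n], this makes the truncated [n - 1 - zeta e] agree with the integer
   difference. *)
have : (zeta e <= 1)%N by rewrite /zeta; case: ifP.
rewrite Hn -/(total_level e); nia.
Qed.
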